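(* Let $S$ be a regular system of paths. (1) If $S$ is $2$-crossing, then $S$ is upper convex or only $2$ paths appear on the upper envelope of $S$. (2) If $S$ is $4$-crossing, then $S$ is upper convex or at most $3$ paths appear on the upper envelope of $S$. (3) If $S$ is $k$-crossing for some $k>4$, then $S$ is upper convex or at most $4$ distinct paths appear on the upper envelope of $S$.
   Context: A path is the graph of a continuous function $f:[0,1]\to\mathbb{R}$. A system of paths is a finite collection of at least three paths such that: the paths have distinct endpoints (the left endpoints are pairwise distinct and the right endpoints are pairwise distinct); any two paths intersect in finitely many points; no two paths are tangent, i.e. paths cross at every point where they intersect; no three paths have a common point. A system is $k$-crossing if each pair of its paths crosses at least $1$ time and at most $k$ times. The size of a system is its number of paths; a subsystem is a subset of at least three of its paths. A path appears on the upper envelope of a system if for some $t\in[0,1]$ it lies strictly above every other path of the system at $t$. A system is upper convex if all of its paths appear on its upper envelope. Signature: for a system of size $3$ whose paths are labeled $i_1<i_2<i_3$ in the order of their left endpoints from bottom to top, its signature is the word on $\{x,y,z\}$ that lists its crossings from left to right, writing $x$ for a crossing of paths $i_1,i_2$, $y$ for a crossing of $i_1,i_3$, and $z$ for a crossing of $i_2,i_3$. A system is regular if it has size at least $4$ and all of its subsystems of size $3$ have the same, non-empty, signature. *)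

(* Defs.v *)
From mathcomp Require Import all_boot all_order all_algebra.
From mathcomp Require Import finmap.
From mathcomp Require Import all_classical all_reals all_analysis.

Set Implicit Arguments.
Unset Strict Implicit.
Unset Printing Implicit Defensive.

Import Order.TTheory GRing.Theory Num.Theory.
Import numFieldNormedType.Exports.
Local Open Scope classical_set_scope.
Local Open Scope card_scope.
Local Open Scope ring_scope.

(* A path is given by a function R -> R that is continuous on [0, 1]; its
   values outside [0, 1] play no role. *)

Section Crossings.
Variable R : realType.
Implicit Types (f g : R -> R) (t : R).

Definition intersections f g : set R :=
  [set t | t \in `[0, 1] /\ f t = g t].

Definition crosses_at f g t : Prop :=
  f t = g t /\
  (((\forall s \near t^'-, f s < g s) /\ (\forall s \near t^'+, g s < f s)) \/
   ((\forall s \near t^'-, g s < f s) /\ (\forall s \near t^'+, f s < g s))).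

(* In a system the endpoints are distinct, so crossings lie in ]0, 1[, where
   the one-sided neighborhoods can be taken inside [0, 1]. *)
Definition crossings f g : set R :=
  [set t | t \in `[0, 1] /\ crosses_at f g t].

End Crossings.

Record is_system (R : realType) (n : nat) (S : 'I_n -> R -> R) : Prop :=
  IsSystem {
    system_size : (3 <= n)%N ;
    system_continuous : forall i, {within `[0, 1], continuous (S i)} ;
    system_left : injective (fun i => S i 0) ;
    system_right : injective (fun i => S i 1) ;
    system_finite : forall i j : 'I_n, i != j ->
      finite_set (intersections (S i) (S j)) ;
    system_not_tangent : forall i j : 'I_n, i != j -> forall t : R,
      intersections (S i) (S j) t -> crosses_at (S i) (S j) t ;
    system_no_triple : forall i j k : 'I_n, i != j -> i != k -> j != k ->
      forall t : R, t \in `[0, 1] -> ~ (S i t = S j t /\ S j t = S k t) }.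

Definition k_crossing (R : realType) (k n : nat) (S : 'I_n -> R -> R) : Prop :=
  forall i j : 'I_n, i != j ->
    crossings (S i) (S j) !=set0 /\ crossings (S i) (S j) #<= `I_k.

Definition on_upper_envelope (R : realType) (n : nat) (S : 'I_n -> R -> R)
    (i : 'I_n) : Prop :=
  exists2 t : R, t \in `[0, 1] & forall j, j != i -> S j t < S i t.

Definition upper_convex (R : realType) (n : nat) (S : 'I_n -> R -> R) : Prop :=
  forall i, on_upper_envelope S i.

Definition envelope_size (R : realType) (n : nat) (S : 'I_n -> R -> R) : nat :=
  #|[pred i | `[< on_upper_envelope S i >]]|.

Inductive letter := Lx | Ly | Lz.

(* The signature of the system {f1, f2, f3}, whose paths are numbered by left
   endpoint from bottom to top: f1 0 < f2 0 < f3 0.  In a system the set below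
   is finite and, since no three paths have a common point, exactly one pair
   crosses at each of its elements. *)
Definition signature (R : realType) (f1 f2 f3 : R -> R) : seq letter :=
  [seq if `[< crosses_at f1 f2 t >] then Lx
       else if `[< crosses_at f1 f3 t >] then Ly else Lz
  | t <- sort <=%R (enum_fset (fset_set
      (crossings f1 f2 `|` crossings f1 f3 `|` crossings f2 f3)))].

(* Each 3-element subsystem is enumerated once, in left-endpoint order. *)
Definition regular_system (R : realType) (n : nat) (S : 'I_n -> R -> R) :
    Prop :=
  [/\ is_system S, (4 <= n)%N &
      exists2 w : seq letter, w <> [::] &
        forall i j k, S i 0 < S j 0 -> S j 0 < S k 0 ->
          signature (S i) (S j) (S k) = w].

(* Main.v *)
From HB Require Import structures.
Require Import Defs.
From mathcomp Require Import all_boot all_order all_algebra.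
From mathcomp Require Import finmap.
From mathcomp Require Import all_classical all_reals all_analysis.
From mathcomp Require Import zify.

(** Number the paths by their left endpoints.  Which of two paths is higher at
    time t is given by the parity of the number of their crossings before t, so
    the order in which a path p meets any two others, and the side on which the
    third path lies at each of these crossings, can be read off the common
    signature w.  A path p that is not the highest one at time 0 reaches the
    upper envelope only by rising above some path j, at their r-th crossing
    say, while every other path k is below; whether k is below depends only on w,
    r and the relative order of p, j, k.  Taking j lowest or highest among the
    paths on its side of p leaves the fewest conditions, so only whether there
    are 0, 1 or at least 2 paths below p, and 1 or at least 2 above, matters.
    Hence all paths of rank neither first, second, last nor last but one behave
    alike; if they appear, so do all the others by passing to subsystems, and
    otherwise at most 4 paths appear.  For at most 4 crossings per pair, the
    words in which every crossing is between vertically adjacent paths are few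
    enough to be enumerated. *)

Set Implicit Arguments.
Unset Strict Implicit.
Unset Printing Implicit Defensive.

Import Order.TTheory GRing.Theory Num.Theory.
Import numFieldNormedType.Exports.
Local Open Scope classical_set_scope.
Local Open Scope ring_scope.

(** * One-sided neighborhoods clear of a finite set of times *)

Section NearFiniteSets.
Variable R : realType.
Implicit Types (s : seq R) (t : R).

Lemma near_left_gt_seq s t :
  \forall u \near t^'-, forall x, x \in s -> x < t -> x < u.
Proof.
elim: s => [|y s IHs]; first by apply: nearW.
have [yt|ty] := ltP y t.
  have yu : \forall u \near t^'-, y < u by exact: nbhs_left_gt.
  near=> u => x; rewrite inE => /predU1P[-> _|xs xt].
    by near: u.
  by move: x xs xt; near: u.
near=> u => x; rewrite inE => /predU1P[-> yt|xs xt].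
  by move: yt; rewrite ltNge ty.
by move: x xs xt; near: u.
Unshelve. all: by end_near. Qed.

Lemma near_right_lt_seq s t :
  \forall u \near t^'+, forall x, x \in s -> t < x -> u < x.
Proof.
elim: s => [|y s IHs]; first by apply: nearW.
have [ty|yt] := ltP t y.
  near=> u => x; rewrite inE => /predU1P[-> _|xs xt].
    by near: u; exact: nbhs_right_lt.
  by move: x xs xt; near: u.
near=> u => x; rewrite inE => /predU1P[-> ty|xs xt].
  by move: ty; rewrite ltNge yt.
by move: x xs xt; near: u.
Unshelve. all: by end_near. Qed.

Lemma last_before s t : has (fun x => x < t) s ->
  exists2 x, x \in s & x < t /\ forall y, y \in s -> y < t -> y <= x.
Proof.
elim: s => //= y s IHs.
have [/IHs[x xs [xt x_max]] _|ns] := boolP (has (fun x => x < t) s).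
  have [yt|ty] := ltP y t; last first.
    exists x; first by rewrite inE xs orbT.
    split=> // z; rewrite inE => /predU1P[-> yt|zs zt]; last exact: x_max.
    by move: yt; rewrite ltNge ty.
  have [yx|xy] := leP y x.
    exists x; first by rewrite inE xs orbT.
    by split=> // z; rewrite inE => /predU1P[->//|zs zt]; exact: x_max.
  exists y; first by rewrite inE eqxx.
  split=> // z; rewrite inE => /predU1P[->//|zs zt].
  by rewrite (le_trans (x_max _ zs zt))// ltW.
rewrite orbF => yt; exists y; first by rewrite inE eqxx.
split=> // z; rewrite inE => /predU1P[->//|zs zt].
by move/hasPn: ns => /(_ z zs); rewrite zt.
Qed.

End NearFiniteSets.

(** * Crossings of two paths and their vertical order *)

Section TwoPaths.
Variable R : realType.
Implicit Types (f g : R -> R) (t u : R).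

Definition crossing_times f g : seq R := enum_fset (fset_set (crossings f g)).

Definition ncross f g t : nat := count (fun x => x < t) (crossing_times f g).

Record crossing_pair f g : Prop := CrossingPair {
  cp_contl : {within `[0, 1], continuous f} ;
  cp_contr : {within `[0, 1], continuous g} ;
  cp_left : f 0 != g 0 ;
  cp_right : f 1 != g 1 ;
  cp_finite : finite_set (intersections f g) ;
  cp_cross : forall t, intersections f g t -> crosses_at f g t }.

Lemma crosses_atC f g t : crosses_at f g t -> crosses_at g f t.
Proof. by move=> [e [[a b]|[a b]]]; split=> //; [right|left]; split. Qed.

Lemma crossingsC f g : crossings f g = crossings g f.
Proof. by apply/seteqP; split=> t [t01 /crosses_atC]. Qed.

Lemma crossing_timesC f g : crossing_times f g = crossing_times g f.
Proof. by rewrite /crossing_times crossingsC. Qed.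

Lemma ncrossC f g t : ncross f g t = ncross g f t.
Proof. by rewrite /ncross crossing_timesC. Qed.

Lemma crossing_times_uniq f g : uniq (crossing_times f g).
Proof. exact: fset_uniq. Qed.

Section Pair.
Variables (f g : R -> R).
Hypothesis fgP : crossing_pair f g.

Lemma crossings_intersections : crossings f g = intersections f g.
Proof.
apply/seteqP; split=> t; first by case=> t01 [].
by move=> it; split; [case: it|exact: cp_cross].
Qed.

Lemma mem_crossing_times t :
  (t \in crossing_times f g) = (t \in `[0, 1]) && (f t == g t).
Proof.
rewrite /crossing_times; rewrite -[LHS]/(t \in fset_set _) in_fset_set; last first.
  by rewrite crossings_intersections; exact: cp_finite.
rewrite crossings_intersections; apply/idP/andP.
  by rewrite inE => -[t01 ->].
by move=> [t01 /eqP e]; rewrite inE.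
Qed.

Lemma crossing_times_in01 t : t \in crossing_times f g -> 0 < t < 1.
Proof.
rewrite mem_crossing_times in_itv/= => /andP[/andP[t0 t1] e].
rewrite !lt_def t0 t1 !andbT; apply/andP; split; apply/eqP => te.
- by move: e; rewrite te (negbTE (cp_left fgP)).
- by move: e; rewrite -te (negbTE (cp_right fgP)).
Qed.

Lemma same_side t u : 0 <= t -> t <= u -> u <= 1 ->
  (forall x, t <= x <= u -> f x != g x) -> (f t < g t) = (f u < g u).
Proof.
move=> t0 tu u1 nox.
have sub : `[t, u]%classic `<=` `[0, 1]%classic.
  move=> x /=; rewrite !in_itv/= => /andP[tx xu].
  by rewrite (le_trans t0)//= (le_trans xu).
have cont : {within `[t, u], continuous (f - g)}.
  apply: (continuous_subspaceW sub); apply: within_continuousB.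
    exact: cp_contl fgP.
  exact: cp_contr fgP.
have noz : ~ (Num.min ((f - g) t) ((f - g) u) <= 0 <= Num.max ((f - g) t) ((f - g) u)).
  move=> /(IVT tu cont)[x]; rewrite in_itv/= => /nox /negP nx e.
  by apply: nx; rewrite -subr_eq0; apply/eqP.
have ft : f t != g t by apply: nox; rewrite lexx.
have fu : f u != g u by apply: nox; rewrite lexx andbT.
have D x : (f - g) x = f x - g x by [].
apply/idP/idP => H; rewrite ltNge; apply/negP => H'; apply: noz;
  rewrite !D ge_min le_max !subr_le0 !subr_ge0.
- by rewrite (ltW H) H' orbT.
- by rewrite (ltW H) H' orbT.
Qed.

Lemma ncross_stable t u : t <= u ->
  (forall x, x \in crossing_times f g -> x < u -> x < t) ->
  ncross f g u = ncross f g t.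
Proof.
move=> tu gap; apply: eq_in_count => x xT.
by apply/idP/idP => [/(gap _ xT)//|xt]; exact: lt_le_trans xt tu.
Qed.

Lemma count_le_crossing t : t \in crossing_times f g ->
  count (fun x => x <= t) (crossing_times f g) = (ncross f g t).+1.
Proof.
move=> tT; rewrite (@eq_count _ _ (predU (pred1 t) (fun x => x < t))); last first.
  by move=> x /=; rewrite -le_eqVlt.
apply/eqP; rewrite -(eqn_add2r
  (count (predI (pred1 t) (fun x => x < t)) (crossing_times f g))).
rewrite count_predUI (count_uniq_mem _ (crossing_times_uniq f g)) tT.
rewrite (@eq_count _ (predI _ _) pred0) ?count_pred0 ?addn0//.
by move=> x /=; case: eqP => // ->; rewrite ltxx.
Qed.

Lemma ncross_step t u : t \in crossing_times f g -> t < u ->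
  (forall x, x \in crossing_times f g -> x < u -> x <= t) ->
  ncross f g u = (ncross f g t).+1.
Proof.
move=> tT tu gap; rewrite -count_le_crossing//; apply: eq_in_count => x xT.
by apply/idP/idP => [/(gap _ xT)//|xt]; exact: le_lt_trans xt tu.
Qed.

(** A crossing is determined by its index, so facts about the [r]-th crossing of a pair, obtained
    separately for each third path, concern one and the same time. *)
Lemma ncross_inj : {in crossing_times f g &, injective (ncross f g)}.
Proof.
move=> t u tT uT; wlog tu : t u tT uT / t < u => [hw e|].
  have [tu|ut|//] := ltgtP t u; [exact: hw|].
  by apply/esym; exact: hw.
suff: (ncross f g t < ncross f g u)%N by move=> /[swap] ->; rewrite ltnn.
by rewrite -count_le_crossing//; apply: sub_count => x /le_lt_trans; apply.
Qed.

(* Between consecutive crossings the intermediate value theorem keeps the two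
   paths in the same vertical order; each crossing reverses it. *)
Lemma ncross_parity t : 0 <= t <= 1 -> f t != g t ->
  (f t < g t) = (f 0 < g 0) (+) odd (ncross f g t).
Proof.
move: {2}(ncross f g t) (erefl (ncross f g t)) => k.
elim: k t => [|k IHk] t nt /andP[t0 t1] ft.
  rewrite nt addbF; apply/esym/same_side => // x /andP[x0 xt].
  apply/negP => fx.
  have xlt : x < t.
    by rewrite lt_def xt andbT; apply/eqP => e; move: ft; rewrite e fx.
  have xT : x \in crossing_times f g.
    by rewrite mem_crossing_times fx in_itv/= x0 (le_trans xt).
  by move/eqP: nt; rewrite /ncross eqn0Ngt -has_count => /hasPn/(_ x xT)/negP.
have : has (fun x => x < t) (crossing_times f g) by rewrite has_count -/(ncross f g t) nt.
move=> /last_before[x xT [xt x_max]].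
have /andP[x0 x1] := crossing_times_in01 xT.
have nx : ncross f g x = k.
  by apply/succn_inj; rewrite -nt (ncross_step xT xt x_max).
have [fx sides] : crosses_at f g x.
  apply: (cp_cross fgP); move: xT; rewrite mem_crossing_times => /andP[x01 /eqP//].
(* [u] lies just left of [x], past every earlier crossing: it has the same count [k] as [x], but the
   paths differ there, so the induction hypothesis applies to it. *)
have [u [u0 ux ugap uside]] : exists u, [/\ 0 <= u, u < x,
    (forall y, y \in crossing_times f g -> y < x -> y < u) & 
    ((f u < g u) /\ (\forall s \near x^'+, g s < f s)) \/
    ((g u < f u) /\ (\forall s \near x^'+, f s < g s))].
  have gap := near_left_gt_seq (crossing_times f g) x.
  have pos : \forall u \near x^'-, 0 <= u.
    have := nbhs_left_gt x0; apply: filterS => u; exact: ltW.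
  have lt : \forall u \near x^'-, u < x by exact: nbhs_left_lt.
  by case: sides => -[sl sr];
    have [u [[a b] [c d]]] := filter_ex (filterI (filterI pos lt) (filterI gap sl));
    exists u; split=> //; [left|right].
have nu : ncross f g u = k by rewrite -nx; apply/esym/ncross_stable => //; exact: ltW.
have fgu : f u != g u by case: uside => -[h _]; rewrite ?(lt_eqF h)// eq_sym (lt_eqF h).
have u01 : 0 <= u <= 1 by rewrite u0 (le_trans (ltW ux))// ltW.
have IHu := IHk u nu u01 fgu.
(* [x] is the last crossing before [t], so the order just right of [x] persists up to [t]. *)
have right_side v : x < v -> v < t -> (f v < g v) = (f t < g t).
  move=> xv vt; apply: same_side => //; [exact: le_trans (ltW x0) (ltW xv)|exact: ltW|].
  move=> y /andP[vy yt]; apply/negP => fy.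
  have ylt : y < t.
    by rewrite lt_def yt andbT; apply/eqP => e; move: ft; rewrite e fy.
  have yT : y \in crossing_times f g.
    rewrite mem_crossing_times fy in_itv/= (le_trans yt t1) andbT andbT.
    by rewrite (le_trans _ vy)// (le_trans (ltW x0) (ltW xv)).
  by have := x_max y yT ylt; rewrite leNgt (lt_le_trans xv vy).
have lt : \forall v \near x^'+, v < t by exact: nbhs_right_lt.
have gt : \forall v \near x^'+, x < v by exact: nbhs_right_gt.
rewrite nt /= addbN -nu -IHu.
case: uside => -[h sr];
  have [v [[xv vt] hv]] := filter_ex (filterI (filterI gt lt) sr);
  rewrite -(right_side v xv vt).
- by rewrite h ltNge (ltW hv).
- by rewrite hv ltNge (ltW h).
Qed.

End Pair.

End TwoPaths.

(** * Words of letters and their parities *)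

Definition letter_eq (a b : letter) : bool :=
  match a, b with Lx, Lx | Ly, Ly | Lz, Lz => true | _, _ => false end.

Lemma letter_eqP : Equality.axiom letter_eq.
Proof. by case; case; constructor. Qed.

HB.instance Definition _ := hasDecEq.Build letter letter_eqP.

(* [event w l r l' b]: just before the [r]-th letter [l] of [w] (counting from
   0), the number of letters [l'] read so far has parity [b]. *)
Definition event (w : seq letter) (l : letter) (r : nat) (l' : letter)
    (b : bool) : bool :=
  has (fun i => [&& nth Lx w i == l, count_mem l (take i w) == r
                  & odd (count_mem l' (take i w)) == b]) (iota 0 (size w)).

(* Two paths that cross are at the same side of the third one; the parities
   of the numbers of previous crossings tell these sides. *)
Definition can_follow (w : seq letter) (l : letter) : bool :=
  match l with
  | Lx => odd (count_mem Ly w) == odd (count_mem Lz w)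
  | Ly => odd (count_mem Lx w) != odd (count_mem Lz w)
  | Lz => odd (count_mem Lx w) == odd (count_mem Ly w)
  end.

Definition drawable (w : seq letter) : Prop :=
  forall i, (i < size w)%N -> can_follow (take i w) (nth Lx w i).

(** * Reading the crossings of three paths off their signature *)

Section Signature.
Variables (R : realType) (f1 f2 f3 : R -> R).
Hypothesis f12P : crossing_pair f1 f2.
Hypothesis f13P : crossing_pair f1 f3.
Hypothesis f23P : crossing_pair f2 f3.
Hypothesis no_triple : forall t, t \in `[0, 1] -> ~ (f1 t = f2 t /\ f2 t = f3 t).

Definition letter_pair (l : letter) : (R -> R) * (R -> R) :=
  match l with Lx => (f1, f2) | Ly => (f1, f3) | Lz => (f2, f3) end.

Definition letter_times l := crossing_times (letter_pair l).1 (letter_pair l).2.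
Definition letter_ncross l := ncross (letter_pair l).1 (letter_pair l).2.

Let w := signature f1 f2 f3.
Let U := crossings f1 f2 `|` crossings f1 f3 `|` crossings f2 f3.
Let T := sort <=%R (enum_fset (fset_set U)).
Let lab t := if `[< crosses_at f1 f2 t >] then Lx
             else if `[< crosses_at f1 f3 t >] then Ly else Lz.

Let wE : w = map lab T. Proof. by []. Qed.

Let cp l : crossing_pair (letter_pair l).1 (letter_pair l).2.
Proof. by case: l. Qed.

Let lcrossP l t : crossings (letter_pair l).1 (letter_pair l).2 t <->
  t \in letter_times l.
Proof.
rewrite crossings_intersections//= mem_crossing_times//.
by split=> [[-> ->]|/andP[? /eqP]]; rewrite ?eqxx.
Qed.

Let memT t : (t \in T) =
  [|| t \in letter_times Lx, t \in letter_times Ly | t \in letter_times Lz].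
Proof.
rewrite mem_sort -[LHS]/(t \in fset_set _) in_fset_set; last first.
  have fin l : finite_set (crossings (letter_pair l).1 (letter_pair l).2).
    by rewrite crossings_intersections//; exact: cp_finite.
  rewrite !finite_setU; split; last exact: (fin Lz).
  by split; [exact: (fin Lx)|exact: (fin Ly)].
apply/idP/idP.
  rewrite inE => -[[]|] h; apply/or3P.
  - by apply: Or31; apply/(lcrossP Lx).
  - by apply: Or32; apply/(lcrossP Ly).
  - by apply: Or33; apply/(lcrossP Lz).
by rewrite inE => /or3P[/lcrossP h|/lcrossP h|/lcrossP h]; [left; left|left; right|right].
Qed.

Let lt_disjoint l l' t : t \in letter_times l -> t \in letter_times l' -> l = l'.
Proof.
rewrite !mem_crossing_times// => /andP[t01 /eqP e] /andP[_ /eqP e'].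
by case: l l' e e' => -[] //= e e'; exfalso; apply: (no_triple t01); split; congruence.
Qed.

(** No point is common to three paths, so the crossing times of the three letters are disjoint and
    the order of the tests in [lab] is immaterial. *)
Let labE l t : t \in T -> (lab t == l) = (t \in letter_times l).
Proof.
have labx u : u \in `[0, 1] -> `[< crosses_at f1 f2 u >] = (u \in letter_times Lx).
  by move=> u01; apply/asboolP/idP => [h|/lcrossP[]//]; exact/lcrossP.
have laby u : u \in `[0, 1] -> `[< crosses_at f1 f3 u >] = (u \in letter_times Ly).
  by move=> u01; apply/asboolP/idP => [h|/lcrossP[]//]; exact/lcrossP.
move=> tT; have t01 : t \in `[0, 1].
  by move: tT; rewrite memT => /or3P[] /lcrossP[].
rewrite /lab labx// laby//; move: tT; rewrite memT.
have d := @lt_disjoint _ _ t.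
case: ifPn => [tx _|_ /=]; last case: ifPn => [ty _|_ /= tz].
- by apply/eqP/idP => [<-//|]; exact: d.
- by apply/eqP/idP => [<-//|]; exact: d.
- by apply/eqP/idP => [<-//|]; exact: d.
Qed.

Let Tuniq : uniq T. Proof. by rewrite sort_uniq; exact: fset_uniq. Qed.

Let Tsorted : sorted <%R T. Proof. by rewrite sort_lt_sorted; exact: fset_uniq. Qed.

Lemma signature_count l : count_mem l w = size (letter_times l).
Proof.
rewrite wE count_map -[RHS]count_predT -size_filter -[RHS]size_filter.
apply/perm_size/uniq_perm; rewrite ?filter_uniq ?crossing_times_uniq// => t.
rewrite !mem_filter /=; apply/andP/idP => [[h tT]|tl].
  by rewrite -labE.
have tT : t \in T by rewrite memT; case: l tl => ->; rewrite ?orbT.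
by rewrite labE.
Qed.

(** [T] is strictly increasing, so its first [i] elements are exactly those before its element of
    index [i]: counts in a prefix become crossing counts at a time. *)
Let take_count l i : (i < size w)%N ->
  count_mem l (take i w) = letter_ncross l (nth 0 T i).
Proof.
rewrite wE size_map => iT; rewrite -map_take count_map.
rewrite -(filter_lt_nth 0 Tsorted iT) -size_filter -filter_predI size_filter.
rewrite /letter_ncross /ncross -!size_filter.
apply/perm_size/uniq_perm; rewrite ?filter_uniq ?crossing_times_uniq// => t.
rewrite !mem_filter /= -andbA andbC -andbA; congr (_ && _).
apply/andP/idP => [[tT h]|tl]; first by rewrite -labE.
have tT : t \in T by rewrite memT; case: l tl => ->; rewrite ?orbT.
by rewrite labE.
Qed.

Lemma event_signature l r l' b : event w l r l' b <->
  exists2 t, t \in letter_times l & letter_ncross l t = r /\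
    odd (letter_ncross l' t) = b.
Proof.
split=> [/hasP[i]|[t tl [tr tb]]].
  rewrite mem_iota add0n => iw /and3P[/eqP wl /eqP wr /eqP wb].
  exists (nth 0 T i); last by rewrite -!take_count.
  rewrite -labE -?(nth_map 0 Lx) ?wl//; last by apply: mem_nth; rewrite wE size_map in iw.
  by rewrite wE size_map in iw.
have tT : t \in T by rewrite memT; case: l tl {tr} => ->; rewrite ?orbT.
have iw : (index t T < size w)%N by rewrite wE size_map index_mem.
apply/hasP; exists (index t T); first by rewrite mem_iota.
rewrite !take_count// nth_index// tr tb !eqxx wE (nth_map 0) ?index_mem// nth_index//.
by rewrite labE// tl.
Qed.

Hypothesis f12 : f1 0 < f2 0.
Hypothesis f23 : f2 0 < f3 0.

Lemma signature_drawable : drawable w.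
Proof.
move=> i iw; have iT : (i < size T)%N by rewrite wE size_map in iw.
have tT : nth 0 T i \in T by exact: mem_nth.
rewrite wE (nth_map 0)// -wE /can_follow; set t := nth 0 T i.
rewrite !take_count// -/t.
have : t \in letter_times (lab t) by rewrite -labE.
have f13 := lt_trans f12 f23.
have t01 : 0 <= t <= 1.
  by move: tT; rewrite memT => /or3P[] /lcrossP[]; rewrite in_itv.
have t01' : t \in `[0, 1] by rewrite in_itv.
have nt := no_triple t01'.
rewrite mem_crossing_times// => /andP[_ /eqP]; case: (lab t) => /= e.
- have ne1 : f1 t != f3 t by apply/eqP => e'; apply: nt; rewrite -e.
  have ne2 : f2 t != f3 t by rewrite -e.
  have := ncross_parity f13P t01 ne1; have := ncross_parity f23P t01 ne2.
  rewrite f13 f23 e !addTb => -> /negb_inj.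
  by move=> h; rewrite /letter_ncross /= h.
(* [f2] starts above [f1] but below [f3], so opposite parities put these two on the same side of
   it. *)
- have ne1 : f1 t != f2 t by apply/eqP => e'; apply: nt; rewrite -e' -e.
  have ne2 : f2 t != f3 t by rewrite -e eq_sym.
  have := ncross_parity f12P t01 ne1; have := ncross_parity f23P t01 ne2.
  have -> : (f1 t < f2 t) = ~~ (f2 t < f3 t) by rewrite e; case: ltgtP ne2.
  rewrite f12 f23 !addTb => -> h; rewrite /letter_ncross /= -(negb_inj h).
  by case: odd.
- have ne1 : f1 t != f2 t by apply/eqP => e'; apply: nt.
  have ne2 : f1 t != f3 t by rewrite -e.
  have := ncross_parity f12P t01 ne1; have := ncross_parity f13P t01 ne2.
  by rewrite f12 f13 e !addTb => -> /negb_inj h; rewrite /letter_ncross /= h.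
Qed.

End Signature.

(** * Conditions on the word and the ranks for reaching the envelope *)

(* [emerges w p j k r]: at the [r]-th crossing of the paths of ranks [p] and
   [j], the path of rank [k] lies below them. *)
Definition emerges (w : seq letter) (p j k r : nat) : bool :=
  if (p < j)%N then
    if (k < p)%N then event w Lz r Lx false
    else if (k < j)%N then event w Ly r Lx true
    else event w Lx r Ly true
  else
    if (k < j)%N then event w Lz r Ly false
    else if (k < p)%N then event w Ly r Lz false
    else event w Lx r Lz true.

(* Among the ranks on one side of a path, rising above the nearest or the
   farthest one requires one of these events, above any other one both. *)
Definition emerges_over_higher w r : bool :=
  event w Ly r Lx true || event w Lx r Ly true.
Definition emerges_over_lower w r : bool :=
  event w Lz r Ly false || event w Ly r Lz false.

(* Whether the path with [p] paths starting below it and [a] above reaches the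
   upper envelope; meaningless for [a = 0], as the highest path always does. *)
Definition rank_tops (w : seq letter) (p a : nat) : bool :=
  has (fun r => if odd r
    then [&& 0 < p, event w Lx r Lz true & (1 < p) ==> emerges_over_lower w r]%N
    else ((0 < p)%N ==> event w Lz r Lx false) &&
         ((1 < a)%N ==> emerges_over_higher w r)) (iota 0 (size w)).

Lemma rank_tops_min w p a : rank_tops w p a = rank_tops w (minn p 2) (minn a 2).
Proof. by case: p a => [|[|p]] [|[|a]]. Qed.

(** By [rank_tops_min] an argument 2 stands for every larger value too; with at least four paths
    these four cases cover all ranks but the highest. *)
Definition bottom_tops w := rank_tops w 0 2.
Definition second_tops w := rank_tops w 1 2.
Definition middle_tops w := rank_tops w 2 2.
Definition penultimate_tops w := rank_tops w 2 1.

Lemma event_lt_size w l r l' b : event w l r l' b -> (r < size w)%N.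
Proof.
move=> /hasP[i]; rewrite mem_iota add0n => iw /and3P[_ /eqP <- _].
by rewrite (leq_ltn_trans (count_size _ _))// size_take_min (leq_ltn_trans (geq_minl _ _)).
Qed.

Lemma emerges_lt_size w p j k r : emerges w p j k r -> (r < size w)%N.
Proof. by rewrite /emerges; do !case: ifP => _; exact: event_lt_size. Qed.

(** With a single path below instead of two, a conjunct drops out; the same happens above in
    [middle_penultimate]. *)
Lemma middle_second w : middle_tops w -> second_tops w.
Proof. by apply: sub_has => r /=; case: ifP => // _ /andP[-> _]. Qed.

Lemma middle_penultimate w : middle_tops w -> penultimate_tops w.
Proof. by apply: sub_has => r /=; case: ifP => // _ /andP[-> _]. Qed.

(** * Enumeration of the short drawable words *)

(* Conditionals rather than [==>] prune the search: [implb] is strict under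
   [vm_compute]. *)
Fixpoint all_extensions (P : pred (seq letter)) (d : nat) (w : seq letter) :=
  P w && (if d is d'.+1 then
    all (fun l => if can_follow w l then all_extensions P d' (rcons w l) else true)
      [:: Lx; Ly; Lz] else true).

Lemma all_extensionsP P d w v : all_extensions P d w -> (size v <= d)%N ->
  (forall i, (i < size v)%N -> can_follow (w ++ take i v) (nth Lx v i)) ->
  P (w ++ v).
Proof.
elim: d w v => [|d IHd] w [|l v] /= /andP[Pw ext] //; rewrite ?cats0// => sv fol.
rewrite -cat_rcons; apply: IHd => //.
  have := fol 0%N isT; rewrite take0 cats0 /= => fl.
  case/and4P: ext => ex ey ez _.
  by case: l {fol} fl => /= fl; [rewrite fl in ex|rewrite fl in ey|rewrite fl in ez].
by move=> i iv; have := fol i.+1 iv; rewrite /= cat_rcons.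
Qed.

(** The letters of the signature of a regular system are equally frequent, whence the guard. When
    the system is not upper convex, the first clause leaves at most two of the ranks bottom, second
    and penultimate on the envelope, and the two clauses together exactly one; the highest path is
    added to these. *)
Definition few_crossings_check (w : seq letter) : bool :=
  let m := count_mem Lx w in
  if [&& m == count_mem Ly w, m == count_mem Lz w, 0 < m & m <= 4]%N then
    (second_tops w && penultimate_tops w ==> middle_tops w) &&
    ((m <= 2)%N ==> [&& bottom_tops w, second_tops w & penultimate_tops w] ||
       (bottom_tops w + second_tops w + penultimate_tops w == 1)%N)
  else true.

(** The length 12 comes from three pairs with at most four crossings each. *)
Lemma few_crossings_computation : all_extensions few_crossings_check 12 [::].
Proof. by vm_compute. Qed.

Lemma few_crossings w : drawable w -> (size w <= 12)%N -> few_crossings_check w.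
Proof. by move=> wd sw; exact: (all_extensionsP few_crossings_computation). Qed.

(** * Reaching the envelope at a crossing *)

Section System.
Variables (R : realType) (n : nat) (S : 'I_n -> R -> R).
Hypothesis sysS : is_system S.

Lemma system_crossing_pair i j : i != j -> crossing_pair (S i) (S j).
Proof.
move=> ij; split.
- exact: system_continuous.
- exact: system_continuous.
- by apply: contra ij => /eqP /(system_left sysS) ->.
- by apply: contra ij => /eqP /(system_right sysS) ->.
- exact: system_finite.
- exact: system_not_tangent.
Qed.

Lemma crossing_others i j k t : i != j -> i != k -> j != k ->
  t \in crossing_times (S i) (S j) -> S k t != S j t.
Proof.
move=> ij ik jk; rewrite mem_crossing_times; last exact: system_crossing_pair.
move=> /andP[t01 /eqP e]; apply/eqP => e'.
by apply: (system_no_triple sysS ij ik jk t01).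
Qed.

(** The crossing sought is the last one before [t] of [p] with a path of [J]; if there is none, the
    order at time 0 is that at [t]. The predicate [J] lets the lemma apply to part of the system. *)
Lemma tops_emerges (J : pred 'I_n) p t : ~~ J p -> 0 <= t <= 1 ->
  (forall j, J j -> S j t < S p t) ->
  (forall j, J j -> S j 0 < S p 0) \/
  exists j u, [/\ J j, u \in crossing_times (S j) (S p),
    odd (ncross (S j) (S p) u) = (S j 0 < S p 0) &
    forall k, J k -> k != j -> S k u < S p u].
Proof.
move=> Jp t01 topt.
have neq j : J j -> j != p by move=> Jj; apply: contraNneq Jp => <-.
have cp j : J j -> crossing_pair (S j) (S p).
  by move=> /neq; exact: system_crossing_pair.
(* At [t] the path [p] is above [j], so an even number of earlier crossings means that [j] started
   below. *)
have par j : J j -> ~~ odd (ncross (S j) (S p) t) = (S j 0 < S p 0).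
  move=> Jj; have /= := ncross_parity (cp j Jj) t01; rewrite topt//.
  by rewrite lt_eqF ?topt// => /(_ isT); case: odd; case: ltP.
pose s := flatten [seq crossing_times (S j) (S p) | j <- enum J].
have memS x : reflect (exists2 j, J j & x \in crossing_times (S j) (S p)) (x \in s).
  apply: (iffP flatten_mapP) => -[j]; first by rewrite mem_enum => *; exists j.
  by move=> Jj xj; exists j; rewrite ?mem_enum.
have [/last_before[u /memS[j Jj uj] [ut u_max]]|nos] := boolP (has (fun x => x < t) s).
  right; exists j, u; split=> //.
    rewrite -(par j Jj) (ncross_step uj ut) ?negbK// => x xj; apply: u_max.
    by apply/memS; exists j.
  move=> k Jk kj; have u01 : 0 <= u <= 1.
    by have /andP[u0 u1] := crossing_times_in01 (cp j Jj) uj; rewrite !ltW.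
  have neu : S k u != S p u.
    by apply: (crossing_others (neq j Jj) _ _ uj); rewrite eq_sym// neq.
  rewrite (ncross_parity (cp k Jk) u01 neu) -(par k Jk).
  (* [k] and [p] do not cross between [u] and [t] by the choice of [u], nor at [u], where [j]
     already meets [p]. *)
  rewrite (@ncross_stable _ _ _ u t) ?(ltW ut)//; first by case: odd.
  move=> x xk xt; rewrite lt_def u_max ?andbT//; last by apply/memS; exists k.
  apply: contraNneq neu => ->; move: xk.
  by rewrite mem_crossing_times//; [case/andP|exact: cp].
left=> j Jj; rewrite -par//; suff -> : ncross (S j) (S p) t = 0%N by [].
apply/eqP; rewrite -leqn0 leqNgt -has_count.
by apply: contra nos => /hasP[x xj xt]; apply/hasP; exists x => //; apply/memS; exists j.
Qed.

(** The time exhibited comes just after [t], before the next crossing of [p] with any path: [p] has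
    overtaken [j], and the other paths are still below. *)
Lemma emerges_tops p j t : j != p -> t \in crossing_times (S j) (S p) ->
  odd (ncross (S j) (S p) t) = (S j 0 < S p 0) ->
  (forall k, k != p -> k != j -> S k t < S p t) -> on_upper_envelope S p.
Proof.
move=> jp tj oddt below.
have /andP[t0 t1] := crossing_times_in01 (system_crossing_pair jp) tj.
pose s := flatten [seq crossing_times (S k) (S p) | k <- enum (predC1 p)].
have memS x k : k != p -> x \in crossing_times (S k) (S p) -> x \in s.
  by move=> kp xk; apply/flatten_mapP; exists k; rewrite ?mem_enum.
have : \forall u \near t^'+, t < u /\ u < 1 /\ forall x, x \in s -> t < x -> u < x.
  apply: filterI; first exact: nbhs_right_gt.
  by apply: filterI; [exact: nbhs_right_lt|exact: near_right_lt_seq].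
move=> /filter_ex[u [tu [u1 gap]]].
have u01 : 0 <= u <= 1 by rewrite (ltW u1) andbT ltW// (lt_trans t0).
exists u; first by rewrite in_itv.
move=> k kp; have cpk := system_crossing_pair kp.
have neu : S k u != S p u.
  apply/negP => e; have uk : u \in crossing_times (S k) (S p).
    by rewrite mem_crossing_times// in_itv/= u01.
  by have := gap u (memS u k kp uk) tu; rewrite ltxx.
have le_t x : x \in crossing_times (S k) (S p) -> x < u -> x <= t.
  move=> xk; apply: contraTT; rewrite -!ltNge -leNgt => tx.
  by apply/ltW/gap => //; exact: memS xk.
rewrite (ncross_parity cpk u01 neu).
have [kj|kj] := eqVneq k j.
  rewrite kj in le_t *; rewrite (ncross_step tj tu)//= oddt.
  by case: ltP.
have t01 : 0 <= t <= 1 by rewrite !ltW.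
have net : S k t != S p t by rewrite lt_eqF ?below.
rewrite (@ncross_stable _ _ _ t u) ?(ltW tu)// -?ncross_parity ?below//.
move=> x xk /(le_t _ xk) xt; rewrite lt_def xt andbT.
apply: contraNneq net => ->; move: xk.
by rewrite mem_crossing_times//; case/andP.
Qed.

End System.

Lemma sum_constant_middle (f : nat -> nat) m c :
  (forall p, (2 <= p < m.+2)%N -> f p = c) ->
  (\sum_(p < m.+4) f p = f 0 + f 1 + m * c + f m.+2 + f m.+3)%N.
Proof.
move=> fc; rewrite 2!big_ord_recr 2!big_ord_recl /= /bump /=.
rewrite (eq_bigr (fun=> c)); first by rewrite sum_nat_const card_ord !addnA !addn0.
by move=> i _; rewrite fc// /bump /=; have := ltn_ord i; lia.
Qed.

Lemma size_letters (w : seq letter) :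
  size w = (count_mem Lx w + count_mem Ly w + count_mem Lz w)%N.
Proof. by elim: w => //= l w ->; case: l => /=; lia. Qed.

(** * Regular systems numbered by left endpoint *)

Section SortedSystem.
Variables (R : realType) (n : nat) (S : 'I_n -> R -> R) (w : seq letter).
Hypothesis sysS : is_system S.
Hypothesis n4 : (4 <= n)%N.
Hypothesis sortS : forall i j : 'I_n, (i < j)%N -> S i 0 < S j 0.
Hypothesis sigS : forall i j k, S i 0 < S j 0 -> S j 0 < S k 0 ->
  signature (S i) (S j) (S k) = w.

Lemma sorted_ltE (i j : 'I_n) : (S i 0 < S j 0) = (i < j)%N.
Proof.
have [/sortS//|ji] := ltnP i j; apply/negbTE; rewrite -leNgt.
by move: ji; rewrite leq_eqVlt => /predU1P[/val_inj ->//|/sortS/ltW].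
Qed.

Let neq (i j : 'I_n) : (i < j)%N -> i != j.
Proof. by move=> ij; rewrite -(inj_eq val_inj) ltn_eqF. Qed.

Let sorted_no_triple (a b c : 'I_n) : (a < b)%N -> (b < c)%N ->
  forall t, t \in `[0, 1] -> ~ (S a t = S b t /\ S b t = S c t).
Proof.
move=> ab bc; apply: (system_no_triple sysS); apply: neq => //.
exact: ltn_trans bc.
Qed.

Lemma event_system (a b c : 'I_n) l r l' x : (a < b)%N -> (b < c)%N ->
  event w l r l' x <->
  exists2 t, t \in letter_times (S a) (S b) (S c) l &
    letter_ncross (S a) (S b) (S c) l t = r /\
    odd (letter_ncross (S a) (S b) (S c) l' t) = x.
Proof.
move=> ab bc; rewrite -(sigS (sortS ab) (sortS bc)).
apply: event_signature; last exact: sorted_no_triple.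
- by apply: system_crossing_pair => //; exact: neq.
- by apply: system_crossing_pair => //; apply: neq; exact: ltn_trans bc.
- by apply: system_crossing_pair => //; exact: neq.
Qed.

Lemma drawable_system : drawable w.
Proof.
have o i : (i < 4)%N -> (i < n)%N by move=> i4; exact: leq_trans n4.
pose a := Ordinal (o 0%N isT); pose b := Ordinal (o 1%N isT).
pose c := Ordinal (o 2%N isT).
have ab : (a < b)%N by []. have bc : (b < c)%N by []. have ac : (a < c)%N by [].
rewrite -(sigS (sortS ab) (sortS bc)); apply: signature_drawable;
  do ?[exact: sortS|exact: sorted_no_triple];
  by apply: system_crossing_pair => //; exact: neq.
Qed.

(** A pair stands for different letters in different triples: among [a], [b], [c], [d], the pair
    [a], [c] is [Ly] in the first triple and [Lx] in [a], [c], [d], while [b], [c] is [Lz] in the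
    first triple and [Lx] in [b], [c], [d]. *)
Lemma letter_counts : exists2 m,
  [/\ count_mem Lx w = m, count_mem Ly w = m & count_mem Lz w = m] &
  exists i j : 'I_n, i != j /\ m = size (crossing_times (S i) (S j)).
Proof.
have o i : (i < 4)%N -> (i < n)%N by move=> i4; exact: leq_trans n4.
pose a := Ordinal (o 0%N isT); pose b := Ordinal (o 1%N isT).
pose c := Ordinal (o 2%N isT); pose d := Ordinal (o 3%N isT).
have cnt (i j k : 'I_n) l : (i < j)%N -> (j < k)%N ->
    count_mem l w = size (letter_times (S i) (S j) (S k) l).
  move=> ij jk; rewrite -(sigS (sortS ij) (sortS jk)).
  apply: signature_count; last exact: sorted_no_triple;
    apply: system_crossing_pair => //; apply: neq => //.
  exact: ltn_trans jk.
exists (count_mem Lx w); last first.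
  by exists a, b; split=> //; rewrite (cnt a b c).
split=> //; first by rewrite (cnt a b c Ly)// (cnt a c d Lx).
by rewrite (cnt a b c Lz)// (cnt b c d Lx).
Qed.

Let third_path (p j : 'I_n) : exists2 k, k != p & k != j.
Proof.
have /card_gt0P[k] : (0 < #|[predC [:: p; j]]|)%N.
  rewrite -(ltn_add2l #|[:: p; j]|) cardC card_ord addn0.
  by rewrite (leq_ltn_trans (card_size _))// (leq_trans _ n4).
by rewrite !inE negb_or => /andP[]; exists k.
Qed.

Let below_parity (p j k : 'I_n) t : j != p -> k != p -> k != j ->
  t \in crossing_times (S j) (S p) ->
  (S k t < S p t) = (odd (ncross (S k) (S p) t) == ~~ (k < p)%N).
Proof.
move=> jp kp kj tj.
have cpk := system_crossing_pair sysS kp.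
have /andP[t0 t1] := crossing_times_in01 (system_crossing_pair sysS jp) tj.
have ne : S k t != S p t.
  by apply: (crossing_others sysS jp _ _ tj); rewrite eq_sym.
rewrite (ncross_parity cpk)//; last by rewrite !ltW.
by rewrite sorted_ltE; case: odd; case: ltnP.
Qed.

Lemma emergesP (p j k : 'I_n) r : j != p -> k != p -> k != j ->
  emerges w p j k r <->
  exists2 t, t \in crossing_times (S j) (S p) &
    ncross (S j) (S p) t = r /\ S k t < S p t.
Proof.
move=> jp kp kj.
(* [l] is the letter of the pair [j], [p] in the sorted triple and [l'] that of [k], [p]; [k] is
   below [p] after an even number of crossings if it started below, and after an odd number
   otherwise, whence [x]. *)
have ev (a b c : 'I_n) l l' x : (a < b)%N -> (b < c)%N -> x = ~~ (k < p)%N ->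
    letter_times (S a) (S b) (S c) l = crossing_times (S j) (S p) ->
    letter_ncross (S a) (S b) (S c) l =1 ncross (S j) (S p) ->
    letter_ncross (S a) (S b) (S c) l' =1 ncross (S k) (S p) ->
    event w l r l' x <->
    exists2 t, t \in crossing_times (S j) (S p) &
      ncross (S j) (S p) t = r /\ S k t < S p t.
  move=> ab bc -> e1 e2 e3; apply: iff_trans (event_system _ _ _ _ ab bc) _.
  rewrite e1; split=> -[t tj [<- h]]; exists t => //; rewrite -?e2; split=> //.
    by rewrite (below_parity jp)// -e3 h.
  by apply/eqP; rewrite e3 -(below_parity jp).
rewrite /emerges.
have [pj|jp'] := ltnP p j; last first.
  have {}jp' : (j < p)%N by rewrite ltn_neqAle jp.
  have [kj'|jk] := ltnP k j.
    apply: (ev k j p) => //; first by rewrite (ltn_trans kj').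
  have {}jk : (j < k)%N by rewrite ltn_neqAle eq_sym kj.
  have [kp'|pk] := ltnP k p.
    by apply: (ev j k p) => //; rewrite kp'.
  have {}pk : (p < k)%N by rewrite ltn_neqAle eq_sym kp.
  apply: (ev j p k) => //; first by rewrite ltnNge ltnW.
  by move=> t; rewrite /letter_ncross /= ncrossC.
have [kp'|pk] := ltnP k p.
  apply: (ev k p j) => //; first by rewrite kp'.
  - exact: crossing_timesC.
  - by move=> t; exact: ncrossC.
have {}pk : (p < k)%N by rewrite ltn_neqAle eq_sym kp.
have [kj'|jk] := ltnP k j.
  apply: (ev p k j) => //; first by rewrite ltnNge ltnW.
  - exact: crossing_timesC.
  - by move=> t; exact: ncrossC.
  - by move=> t; exact: ncrossC.
have {}jk : (j < k)%N by rewrite ltn_neqAle eq_sym kj.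
apply: (ev p j k) => //; first by rewrite ltnNge ltnW.
- exact: crossing_timesC.
- by move=> t; exact: ncrossC.
- by move=> t; exact: ncrossC.
Qed.

(** [q] starts above [p], which rules out that [p] was above all of [J] from the start. *)
Lemma tops_word (J : pred 'I_n) (p q : 'I_n) t : ~~ J p -> J q -> (p < q)%N ->
  0 <= t <= 1 -> (forall j, J j -> S j t < S p t) ->
  exists j r, [/\ J j, odd r = (j < p)%N &
    forall k, J k -> k != j -> emerges w p j k r].
Proof.
move=> Jp Jq pq t01 /(tops_emerges sysS Jp t01)[/(_ q Jq)|].
  by rewrite sorted_ltE ltnNge ltnW.
move=> [j [u [Jj uj par below]]]; exists j, (ncross (S j) (S p) u).
rewrite par sorted_ltE; split=> // k Jk kj.
have np i : J i -> i != p by move=> Ji; apply: contraNneq Jp => <-.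
apply/emergesP; rewrite ?np//; exists u => //; split=> //; exact: below.
Qed.

Lemma word_tops (p j : 'I_n) r : j != p -> odd r = (j < p)%N ->
  (forall k, k != p -> k != j -> emerges w p j k r) -> on_upper_envelope S p.
Proof.
move=> jp oddr em.
(* The condition for some third path supplies the [r]-th crossing of [j] and [p]. *)
have [q qp qj] := third_path p j.
have /emergesP[//|//|//|t tj [tr _]] := em q qp qj.
apply: (emerges_tops sysS jp tj); rewrite ?tr ?sorted_ltE// => k kp kj.
have /emergesP[//|//|//|t' tj' [tr' lt]] := em k kp kj.
by rewrite (ncross_inj tj tj') ?tr.
Qed.

(** Forgetting the order of [j] and [k] when both are on one side of [p] leaves a condition that
    depends on [j] only through its side of [p]. *)
Let emergesN (p j k : 'I_n) r : j != p -> k != p -> k != j -> emerges w p j k r ->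
  if (p < j)%N then
    if (k < p)%N then event w Lz r Lx false
    else emerges_over_higher w r
  else if (k < p)%N then emerges_over_lower w r else event w Lx r Lz true.
Proof.
move=> jp kp kj; rewrite /emerges /emerges_over_higher /emerges_over_lower.
have [pj|] := ltnP p j.
  by have [//|pk] := ltnP k p; case: ifP => _ ->; rewrite ?orbT.
rewrite leq_eqVlt (negbTE (jp : (j : nat) != p)) /= => jp'.
have [kj'|jk] := ltnP k j; first by rewrite (ltn_trans kj') // => ->.
by case: ifP => // _ ->; rewrite orbT.
Qed.

(** Necessity applies [emergesN] to one [k] on each side of [p]. For sufficiency, [j] is taken
    extreme among the ranks on its side, so that the others there are all above or all below [j] in
    rank and a single event settles them. *)
Lemma envelope_rank_tops (p : 'I_n) : (p.+1 < n)%N ->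
  on_upper_envelope S p <-> rank_tops w p (n - p.+1).
Proof.
move=> pn; have p_lt := ltn_ord p.
pose q := Ordinal pn; have n0 : (0 < n)%N by exact: leq_trans n4.
pose o0 := Ordinal n0; have n1n : (n.-1 < n)%N by rewrite prednK.
pose omax := Ordinal n1n.
split=> [[t]|/hasP[r _]].
  rewrite in_itv/= => t01 top.
  have qp : q != p by rewrite eq_sym neq.
  have pp : ~~ predC1 p p by rewrite /= eqxx.
  have [j [r [jp oddr em]]] := tops_word pp (qp : predC1 p q) (ltnSn p) t01 top.
  have em' k : k != p -> k != j -> _ := fun kp kj => emergesN jp kp kj (em k kp kj).
  apply/hasP; exists r.
    have [k kp kj] := third_path p j.
    by rewrite mem_iota (emerges_lt_size (em k kp kj)).
  rewrite oddr; case: ifPn => [jp'|].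
    have pj : (p < j)%N = false by rewrite ltnNge ltnW.
    rewrite pj in em'; rewrite (leq_ltn_trans _ jp')//=; apply/andP; split.
      have := em' q; rewrite ltnNge leqnSn /=; apply; rewrite eq_sym neq//.
      exact: ltnW.
    (* [k] is a rank below [p] other than [j]: 0, or 1 when [j] is 0. *)
    apply/implyP => p1; pose k := if j == o0 :> nat then Ordinal (ltn_trans p1 p_lt) else o0.
    have := em' k; rewrite /k; case: ifPn => [/eqP j0|j0] /=.
      rewrite p1; apply; rewrite -(inj_eq val_inj) /=; first by rewrite ltn_eqF.
      by rewrite j0.
    rewrite (leq_ltn_trans _ jp')//; apply; rewrite -(inj_eq val_inj) /= eq_sym//.
    by rewrite -lt0n (leq_ltn_trans _ jp').
  rewrite -leqNgt => pj.
  have {}pj : (p < j)%N by rewrite ltn_neqAle pj andbT eq_sym.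
  rewrite pj in em'; apply/andP; split; apply/implyP => h.
    have := em' o0; rewrite h; apply; first by apply: neq.
    by apply: neq; exact: ltn_trans pj.
  have h' : (p.+2 < n)%N by rewrite -subn_gt0 in h *; lia.
  pose k := if j == q :> nat then Ordinal h' else q.
  have pk : (p < k)%N by rewrite /k; case: ifP => _ /=.
  have := em' k; rewrite ltnNge ltnW//=; apply; first by rewrite eq_sym neq.
  rewrite -(inj_eq val_inj) /k; case: ifPn => /=; last by rewrite eq_sym.
  by move=> /eqP ->; rewrite /= gtn_eqF.
(* In [he] the path [j] started above [p], in [ho] below it. *)
have he (j : 'I_n) : (p < j)%N -> ~~ odd r -> 
  ((0 < p)%N -> event w Lz r Lx false) ->
  ((exists2 k : 'I_n, (p < k)%N & (k < j)%N) -> event w Ly r Lx true) ->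
  ((exists2 k : 'I_n, (p < k)%N & (j < k)%N) -> event w Lx r Ly true) ->
  on_upper_envelope S p.
  move=> pj or h1 h2 h3; apply: (@word_tops p j r).
  - by rewrite eq_sym neq.
  - by rewrite (negbTE or) ltnNge ltnW.
  move=> k kp kj; rewrite /emerges pj.
  have [kp'|pk] := ltnP k p; first by apply: h1; exact: leq_ltn_trans kp'.
  have {}pk : (p < k)%N by rewrite ltn_neqAle eq_sym kp.
  have [kj'|jk] := ltnP k j; first by apply: h2; exists k.
  by apply: h3; exists k => //; rewrite ltn_neqAle eq_sym kj.
have ho (j : 'I_n) : (j < p)%N -> odd r ->
  event w Lx r Lz true ->
  ((exists2 k : 'I_n, (k < p)%N & (k < j)%N) -> event w Lz r Ly false) ->
  ((exists2 k : 'I_n, (k < p)%N & (j < k)%N) -> event w Ly r Lz false) ->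
  on_upper_envelope S p.
  move=> jp or h1 h2 h3; apply: (@word_tops p j r).
  - by rewrite neq.
  - by rewrite or jp.
  move=> k kp kj; rewrite /emerges ltnNge ltnW//=.
  have [kj'|jk] := ltnP k j; first by apply: h2; exists k => //; exact: ltn_trans jp.
  have {}jk : (j < k)%N by rewrite ltn_neqAle eq_sym kj.
  by case: ifP => // kp'; apply: h3; exists k.
case: ifPn => or.
  case/and3P=> p0 e6 /implyP.
  have [p1|p1] := ltnP 1 p; last first.
    move=> _; apply: (ho o0) => //; first by case.
    by case=> k /= kp k0; lia.
  (* [e4] handles the ranks below [j], so [j] is the nearest below [p]; [e5] handles those between
     [j] and [p], so [j] is the lowest. *)
  move=> /(_ isT)/orP[e4|e5].
    have pp : (p.-1 < n)%N by lia.
    apply: (ho (Ordinal pp)) => //=; first by lia.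
    by case=> k kp k1; lia.
  by apply: (ho o0) => //; case.
case/andP=> /implyP e1 /implyP.
have [a1|a1] := ltnP 1 (n - p.+1); last first.
  move=> _; apply: (he q) => //=.
    by case=> k /= kp k0; lia.
  by case=> k /= kp k0; have := ltn_ord k; lia.
(* Likewise [e2] calls for the highest [j] and [e3] for the nearest above [p]. *)
move=> /(_ isT)/orP[e2|e3].
  apply: (he omax) => //=; first by lia.
  by case=> k /= kp k0; have := ltn_ord k; lia.
apply: (he q) => //=.
by case=> k /= kp k0; lia.
Qed.

Lemma top_on_envelope (p : 'I_n) : p.+1 = n -> on_upper_envelope S p.
Proof.
move=> pn; exists 0; first by rewrite in_itv/= lexx ler01.
by move=> j jp; apply: sortS; have := ltn_ord j; rewrite -(inj_eq val_inj)/= in jp; lia.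
Qed.

(* Discarding the ranks 0 and 1 turns rank 2 into the bottom one. *)
Lemma middle_bottom : (4 < n)%N -> middle_tops w -> bottom_tops w.
Proof.
move=> n5 mid.
have o i : (i < 5)%N -> (i < n)%N by move=> i5; exact: leq_trans n5.
pose p := Ordinal (o 2%N isT); pose q := Ordinal (o 3%N isT).
pose q' := Ordinal (o 4%N isT).
have topm : rank_tops w p (n - p.+1).
  by rewrite rank_tops_min (minn_idPr (_ : 2 <= n - p.+1)%N) //= ltn_subRL.
have [t] := (envelope_rank_tops (p := p) (o 3%N isT)).2 topm.
rewrite in_itv/= => t01 top.
pose J : pred 'I_n := fun k => (p < k)%N.
have pp : ~~ J p by rewrite /J ltnn.
have topJ j : J j -> S j t < S p t by move=> Jj; apply: top; rewrite eq_sym neq.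
have [j [r [Jj oddr em]]] := tops_word pp (ltnSn p : J q) (ltnSn p) t01 topJ.
pose k := if j == q then q' else q.
have Jk : J k by rewrite /k /J; case: ifP.
have kj : k != j by rewrite /k; case: ifPn => [/eqP ->|]; rewrite // eq_sym.
have emk := em k Jk kj.
apply/hasP; exists r; first by rewrite mem_iota (emerges_lt_size emk).
have jp : j != p by rewrite eq_sym neq.
have kp : k != p by rewrite eq_sym neq.
have pj : (p < j)%N := Jj; have pk : (p < k)%N := Jk.
(* All of [J] starts above [p], so [r] is even and [emergesN] gives [emerges_over_higher], which is
   all that rank 0 requires. *)
have := emergesN jp kp kj emk; rewrite oddr !(ltnNge _ p) (ltnW pj) (ltnW pk) pj /=.
by move->.
Qed.

Definition rank_on_envelope (p : nat) : bool :=
  (p.+1 == n)%N || rank_tops w p (n - p.+1).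

Lemma rank_on_envelopeP (p : 'I_n) :
  reflect (on_upper_envelope S p) (rank_on_envelope p).
Proof.
rewrite /rank_on_envelope; have [pn|pn] := eqVneq p.+1 n.
  by apply: ReflectT; exact: top_on_envelope.
have p_lt : (p.+1 < n)%N by rewrite ltn_neqAle pn ltn_ord.
exact: (iffP idP) (envelope_rank_tops p_lt).2 (envelope_rank_tops p_lt).1.
Qed.

Lemma envelope_size_rank : envelope_size S =
  (bottom_tops w + second_tops w + (n - 4) * middle_tops w
   + penultimate_tops w + 1)%N.
Proof.
transitivity (\sum_(p < n) rank_on_envelope p)%N.
  rewrite /envelope_size -sum1_card big_mkcond; apply: eq_bigr => p _ /=.
  by rewrite inE (asbool_equiv_eqP (rank_on_envelopeP p) (iff_refl _)); case: rank_on_envelope.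
have rE p : (p < n.-1)%N ->
    rank_on_envelope p = rank_tops w (minn p 2) (minn (n - p.+1) 2).
  by move=> pn; rewrite /rank_on_envelope -rank_tops_min ltn_eqF//; lia.
have nE : ((n - 4).+4 = n)%N by rewrite -addn4 subnK.
transitivity (\sum_(p < (n - 4).+4) rank_on_envelope p)%N.
  by rewrite -!(big_mkord xpredT (fun p => nat_of_bool (rank_on_envelope p))) nE.
rewrite (@sum_constant_middle (fun p => rank_on_envelope p) (n - 4) (middle_tops w)).
  have -> : rank_on_envelope (n - 4).+3 by rewrite /rank_on_envelope nE eqxx.
  rewrite !rE; [|lia..].
  have -> : minn (n - 1) 2 = 2 by lia.
  have -> : minn (n - 2) 2 = 2 by lia.
  have -> : minn (n - (n - 4).+3) 2 = 1%N by lia.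
  by rewrite (minn_idPr (_ : 2 <= (n - 4).+2)%N).
move=> p /andP[p2 pn]; rewrite rE; last by lia.
by have -> : minn p 2 = 2; [lia|have -> : minn (n - p.+1) 2 = 2; [lia|]].
Qed.

(** Four paths leave no middle rank, whence the alternative [n == 4]. *)
Lemma upper_convex_ranks :
  [&& bottom_tops w, second_tops w, penultimate_tops w & (n == 4) || middle_tops w] ->
  upper_convex S.
Proof.
case/and4P=> bot sec pen mid p; apply/rank_on_envelopeP.
rewrite /rank_on_envelope; have [//|pn /=] := eqVneq p.+1 n.
have p_lt := ltn_ord p; rewrite rank_tops_min.
have [p1|p2] := ltnP p 2.
  have -> : minn (n - p.+1) 2 = 2 by lia.
  by case: (p : nat) p1 => [|[|]].
have [pm|pm] := ltnP p (n - 2); last first.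
  by have -> : minn (n - p.+1) 2 = 1%N by lia.
have -> : minn (n - p.+1) 2 = 2 by lia.
by case/orP: mid => // /eqP; lia.
Qed.

Lemma sorted_envelope_size :
  (k_crossing 2 S -> upper_convex S \/ envelope_size S = 2%N) /\
  (k_crossing 4 S -> upper_convex S \/ (envelope_size S <= 3)%N) /\
  (upper_convex S \/ (envelope_size S <= 4)%N).
Proof.
have [m [mx my mz] [i [j [ij mE]]]] := letter_counts.
have m_gt0 k : k_crossing k S -> (0 < m)%N.
  move=> /(_ i j ij)[[t]].
  rewrite (crossings_intersections (system_crossing_pair sysS ij)) => -[t01 e] _.
  rewrite mE lt0n size_eq0; apply/eqP => T0.
  have : t \in crossing_times (S i) (S j).
    by rewrite mem_crossing_times ?t01 ?e ?eqxx//; exact: system_crossing_pair.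
  by rewrite T0.
have m_le k : k_crossing k S -> (m <= k)%N.
  move=> /(_ i j ij)[_]; rewrite mE -[size _]/(#|` fset_set (crossings (S i) (S j))|).
  apply: geq_card_fset_set.
have check k : k_crossing k S -> (k <= 4)%N ->
    (second_tops w && penultimate_tops w ==> middle_tops w) &&
    ((m <= 2)%N ==> [&& bottom_tops w, second_tops w & penultimate_tops w] ||
       (bottom_tops w + second_tops w + penultimate_tops w == 1)%N).
  move=> kS k4; have m4 := leq_trans (m_le k kS) k4.
  have : few_crossings_check w.
    by apply: few_crossings; [exact: drawable_system|rewrite size_letters mx my mz; lia].
  by rewrite /few_crossings_check mx my mz eqxx (m_gt0 k kS) m4.
(* If a middle rank exists and reaches the envelope, so do all the other ranks; hence the middle
   ranks contribute nothing here. *)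
have sizeE : ~~ [&& bottom_tops w, second_tops w, penultimate_tops w
                 & (n == 4) || middle_tops w] ->
    envelope_size S = (bottom_tops w + second_tops w + penultimate_tops w + 1)%N.
  rewrite envelope_size_rank => nconv.
  suff -> : ((n - 4) * middle_tops w = 0)%N by rewrite addn0.
  have [->|n_neq4] := eqVneq n 4%N; first by rewrite subnn.
  case: (boolP (middle_tops w)) nconv => [mid|_ _]; last by rewrite muln0.
  rewrite middle_bottom ?middle_second ?middle_penultimate ?orbT//.
  by rewrite ltn_neqAle eq_sym n_neq4.
have [conv|nconv] := boolP [&& bottom_tops w, second_tops w, penultimate_tops w
                             & (n == 4) || middle_tops w].
  by have := upper_convex_ranks conv; tauto.
rewrite (sizeE nconv); split; [|split].
- move=> kS; right; have := check 2%N kS isT; rewrite (m_le 2%N kS) /= => /andP[sp].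
  case/orP => [/and3P[b s p]|/eqP ->//].
  by move: nconv; rewrite b s p /= (implyP sp) ?s ?p// orbT.
- move=> kS; right; have /andP[sp _] := check 4%N kS isT.
  move: nconv sp; case: (bottom_tops w); case: (second_tops w);
    by case: (penultimate_tops w); case: (middle_tops w); rewrite ?orbT.
- by right; case: (bottom_tops w); case: (second_tops w); case: (penultimate_tops w).
Qed.

End SortedSystem.

(** * Reduction to paths numbered by left endpoint *)

Lemma sorted_numbering (R : realType) (n : nat) (S : 'I_n -> R -> R) :
  injective (fun i => S i 0) ->
  exists2 s : 'I_n -> 'I_n, bijective s &
    forall i j : 'I_n, (i < j)%N -> S (s i) 0 < S (s j) 0.
Proof.
move=> injS; pose le_left (i j : 'I_n) := S i 0 <= S j 0.
pose e := sort le_left (enum 'I_n).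
have size_e : size e = n by rewrite size_sort size_enum_ord.
have uniq_e : uniq e by rewrite sort_uniq enum_uniq.
pose s (i : 'I_n) := nth i e i.
have sE (x i : 'I_n) : s i = nth x e i by apply: set_nth_default; rewrite size_e ltn_ord.
have s_inj : injective s.
  move=> i j; rewrite (sE i j) => /eqP.
  by rewrite nth_uniq ?size_e// => /eqP/val_inj.
exists s => [|i j ij]; first exact: injF_bij.
rewrite lt_def; apply/andP; split.
  by apply/eqP => /injS/s_inj ji; move: ij; rewrite ji ltnn.
have tr : transitive le_left by move=> x y z; exact: le_trans.
have tot : total le_left by move=> x y; exact: le_total.
rewrite (sE i j).
by apply: (sorted_ltn_nth tr); rewrite ?inE ?size_e ?ltn_ord ?sort_sorted.
Qed.

Theorem theorem2p16 (R : realType) (n : nat) (S : 'I_n -> R -> R)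
  (hS : regular_system S) :
  (k_crossing 2 S -> upper_convex S \/ envelope_size S = 2%N) /\
  (k_crossing 4 S -> upper_convex S \/ (envelope_size S <= 3)%N) /\
  (forall k : nat, (4 < k)%N -> k_crossing k S ->
     upper_convex S \/ (envelope_size S <= 4)%N).
Proof.
case: hS => sysS n4 [w _ sigS].
have [s [s' sK s'K] sortS] := sorted_numbering (system_left sysS).
have s_inj := can_inj sK.
have neq i j : i != j -> s i != s j by rewrite (inj_eq s_inj).
pose S' i := S (s i).
have sysS' : is_system S'.
  split.
  - exact: system_size sysS.
  - by move=> i; exact: (system_continuous sysS).
  - by move=> i j /(system_left sysS)/s_inj.
  - by move=> i j /(system_right sysS)/s_inj.
  - by move=> i j /neq; exact: (system_finite sysS).
  - by move=> i j /neq; exact: (system_not_tangent sysS).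
  - by move=> i j k /neq ij /neq ik /neq; exact: (system_no_triple sysS).
have crossS' k : k_crossing k S -> k_crossing k S' by move=> kS i j /neq; exact: kS.
have onS' i : on_upper_envelope S' i <-> on_upper_envelope S (s i).
  split=> -[t t01 top]; exists t => // j ji.
    by rewrite -(s'K j); apply: top; rewrite -(inj_eq s_inj) s'K.
  exact/top/neq.
have sizeS' : envelope_size S' = envelope_size S.
  rewrite /envelope_size -(fintype.card_image s_inj); apply: eq_card => i.
  rewrite -(s'K i) fintype.mem_image// !inE; exact: asbool_equiv_eq.
have convS' : upper_convex S' -> upper_convex S.
  by move=> conv i; rewrite -(s'K i); apply/onS'.
have [two [four many]] :=
  sorted_envelope_size sysS' n4 sortS (fun i j k => sigS (s i) (s j) (s k)).
rewrite sizeS' in two four many.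
split=> [/crossS'/two|]; first by tauto.
by split=> [/crossS'/four|k _ _]; tauto.
Qed.
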